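(* Let $F$ be a field and let $G$ be a finitely presented group which is not residually finite. Then there exists an elementary $G$-grading on a full matrix algebra $M_n(F)$ (for some $n\in\mathbb N$) which is not weakly equivalent to any $H$-grading for any finite (semi)group $H$.
   Context: A group is residually finite if the intersection of its normal subgroups of finite index is trivial. A grading of an $F$-algebra $A$ by a (semi)group $S$ is a decomposition $A=\bigoplus_{s\in S}A^{(s)}$ into subspaces with $A^{(s)}A^{(t)}\subseteq A^{(st)}$. Two gradings $A=\bigoplus_{s\in S}A^{(s)}$ and $B=\bigoplus_{t\in T}B^{(t)}$ by (semi)groups are weakly equivalent if there is an algebra isomorphism $\varphi\colon A\to B$ such that for every $s\in S$ with $A^{(s)}\neq0$ there is $t\in T$ with $\varphi(A^{(s)})=B^{(t)}$. The elementary $G$-grading on $M_n(F)$ defined by an $n$-tuple $(g_1,\dots,g_n)$ of elements of $G$ is the grading in which each matrix unit $e_{ij}$ is homogeneous of degree $g_ig_j^{-1}$. ''(Semi)group'' means a group or, more generally, a semigroup. *)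

(* Defs.v *)
From HB Require Import structures.
From mathcomp Require Import all_boot all_order all_algebra.
From mathcomp Require Import boolp classical_sets functions cardinality.

Set Implicit Arguments.
Unset Strict Implicit.
Unset Printing Implicit Defensive.

Import GRing.Theory.

Local Open Scope classical_set_scope.

Section Groups.
Local Open Scope group_scope.

Definition normal_subgroup (G : groupType) (N : set G) : Prop :=
  group_closed [in N] /\ forall g x : G, N x -> N (x ^ g).

Definition finite_index (G : groupType) (N : set G) : Prop :=
  finite_set [set [set g * h | h in N] | g in [set: G]].

Definition residually_finite (G : groupType) : Prop :=
  \bigcap_(N in [set N : set G | normal_subgroup N /\ finite_index N]) N
  = [set 1].

(* Words in the letters x_i and x_i^-1; the letter (i, b) stands for x_i^-1
   when b is true. *)
Definition word (k : nat) : Type := seq ('I_k * bool).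

(* Equality of words in the group < x_0, ..., x_{k-1} | R >. *)
Inductive presented_eq (k : nat) (R : seq (word k)) : word k -> word k -> Prop :=
| presented_refl w : presented_eq R w w
| presented_sym v w : presented_eq R v w -> presented_eq R w v
| presented_trans u v w :
    presented_eq R u v -> presented_eq R v w -> presented_eq R u w
| presented_cancel u v i b :
    presented_eq R (u ++ [:: (i, b); (i, ~~ b)] ++ v) (u ++ v)
| presented_relator u v r :
    r \in R -> presented_eq R (u ++ r ++ v) (u ++ v).

Definition word_eval (G : groupType) (k : nat) (x : 'I_k -> G) (w : word k) : G :=
  \prod_(l <- w) (if l.2 then (x l.1)^-1 else x l.1).

(* Word evaluation induces an isomorphism from < x_0, ..., x_{k-1} | R >
   onto G. *)
Definition finitely_presented (G : groupType) : Prop :=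
  exists (k : nat) (R : seq (word k)) (x : 'I_k -> G),
    (forall g : G, exists w : word k, word_eval x w = g) /\
    (forall v w : word k, word_eval x v = word_eval x w <-> presented_eq R v w).

End Groups.

Section Gradings.
Local Open Scope ring_scope.

(* [gr_total] and [gr_direct] say that A is the internal direct sum of the
   components; the support of a sum is a duplicate-free finite sequence since
   S may be infinite. *)
Record grading (F : fieldType) (S : semigroupType) (A : algType F) := Grading {
  component :> S -> set A;
  gr_submod : forall s, submod_closed [in component s];
  gr_total : forall a : A, exists (r : seq S) (f : S -> A),
    [/\ uniq r, (forall s, component s (f s)) & a = \sum_(s <- r) f s];
  gr_direct : forall (r : seq S) (f : S -> A),
    uniq r -> (forall s, component s (f s)) -> \sum_(s <- r) f s = 0 ->
    forall s, s \in r -> f s = 0;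
  gr_mul : forall (s t : S) (a b : A),
    component s a -> component t b -> component (s * t)%g (a * b)
}.

Definition weakly_equivalent (F : fieldType) (S T : semigroupType)
    (A B : algType F) (U : grading S A) (V : grading T B) : Prop :=
  exists phi : {lrmorphism A -> B},
    bijective phi /\
    forall s : S, U s <> [set 0] -> exists t : T, phi @` (U s) = V t.

(* The matrix units span the algebra, so at most one grading satisfies this. *)
Definition elementary_grading (F : fieldType) (G : groupType) (n : nat)
    (g : 'I_n.+1 -> G) (U : grading G 'M[F]_n.+1) : Prop :=
  forall i j : 'I_n.+1, U (g i * (g j)^-1)%g (delta_mx i j).

End Gradings.

(* Main.v *)
Require Import Defs.
From HB Require Import structures.
From mathcomp Require Import all_boot all_order all_algebra.
From mathcomp Require Import boolp classical_sets functions cardinality.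

Set Implicit Arguments.
Unset Strict Implicit.
Unset Printing Implicit Defensive.

Import GRing.Theory.

(** Write G = < x_0, ..., x_{k-1} | R > and choose an element g0 <> 1 lying in
every normal subgroup of finite index, together with a word w0 representing it.
The tuple (g_i) consists of the generators and of the values of all suffixes of
w0 and of the relators; the grading is the elementary one it defines.

Suppose phi is a weak equivalence onto a grading V by a finite semigroup H, and
let theta send a degree s of the support to a degree of H with
phi (U s) = V (theta s).  Since e_ij e_jk = e_ik is nonzero and a nonzero element
is homogeneous of one degree only,
  theta (g_i g_j^-1) theta (g_j g_k^-1) = theta (g_i g_k^-1),
so theta is multiplicative on the quotients of entries of the tuple
([weak_equivalence_degree_map]).  It is injective on the support, because phi is.

Multiplying the images of its letters sends every word into H.  The suffixes in
the tuple allow a relator, or w0, to be multiplied out one letter at a time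
without leaving the support: relators go to theta 1 and w0 goes to theta g0.
Hence the map factors through the presentation and gives a multiplicative map
G -> H ([presented_extension]).  Such a map is constant on the finite residual
([finite_residual_morph]), since its fibre over the image of 1 is a normal
subgroup of finite index.  Therefore theta g0 = theta 1, against injectivity. *)

(** * Multiplicative maps to finite semigroups *)

Section FiniteResidual.
Local Open Scope group_scope.
Local Open Scope classical_set_scope.

Definition finite_residual (G : groupType) : set G :=
  \bigcap_(N in [set N : set G | normal_subgroup N /\ finite_index N]) N.

(** The elements mapped to [F 1] form a normal subgroup whose cosets are the
fibres of [F], so its index is at most the cardinal of [H]. *)
Lemma finite_residual_morph (G : groupType) (H : semigroupType) (F : G -> H) :
  {morph F : g h / g * h} -> finite_set [set: H] ->
  forall g, finite_residual g -> F g = F 1.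
Proof.
move=> FM finH g0 resg0.
pose N := [set g | F g = F 1].
have F1l g : F 1 * F g = F g by rewrite -FM mul1g.
have F1r g : F g * F 1 = F g by rewrite -FM mulg1.
have FVl g : F g^-1 * F g = F 1 by rewrite -FM mulVg.
have FVr g : F g * F g^-1 = F 1 by rewrite -FM mulgV.
apply: (resg0 N); split.
  split; last by move=> g h; rewrite /N /= /conjg !FM => ->; rewrite F1l FVl.
  split; first by rewrite inE.
  by move=> g h; rewrite !inE /N /= FM => -> Fh; rewrite -Fh FVr.
apply: (@sub_finite_set _ _ [set F @^-1` [set t] | t in [set: H]]); last first.
  exact: finite_image.
move=> _ /= [g _ <-]; exists (F g) => //.
apply/seteqP; split=> [h /= Fh|_ /= [h Nh <-]].
  by exists (g^-1 * h); rewrite ?mulVKg // /N /= FM Fh FVl.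
by rewrite FM Nh F1r.
Qed.

End FiniteResidual.

(** * Extending a partial multiplication along a presentation *)

Section PresentedExtension.
Local Open Scope group_scope.
Local Open Scope classical_set_scope.

Definition letter_eval (G : groupType) (k : nat) (x : 'I_k -> G)
  (l : 'I_k * bool) : G := if l.2 then (x l.1)^-1 else x l.1.

Lemma word_eval_cons (G : groupType) (k : nat) (x : 'I_k -> G) l (w : word k) :
  word_eval x (l :: w) = letter_eval x l * word_eval x w.
Proof. by rewrite /word_eval big_cons. Qed.

Lemma word_eval_cat (G : groupType) (k : nat) (x : 'I_k -> G) (v w : word k) :
  word_eval x (v ++ w) = word_eval x v * word_eval x w.
Proof. by rewrite /word_eval big_cat. Qed.

Definition quotient_morph (G : groupType) (H : semigroupType) (P : set G)
    (theta : G -> H) : Prop :=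
  forall a b c, P a -> P b -> P c ->
    theta (a * b^-1) * theta (b * c^-1) = theta (a * c^-1).

(** In the semigroup [H] there is no empty product, so [theta 1] takes its
place. *)
Definition word_image (G : groupType) (H : semigroupType) (theta : G -> H)
    (k : nat) (x : 'I_k -> G) (w : word k) : H :=
  foldr (fun l h => theta (letter_eval x l) * h) (theta 1) w.

Variables (G : groupType) (H : semigroupType) (k : nat) (x : 'I_k -> G).
Variables (P : set G) (theta : G -> H).
Hypotheses (P1 : P 1) (Px : forall i, P (x i)) (thetaM : quotient_morph P theta).

Local Notation image := (word_image theta x).

(** Every letter is a quotient of elements of [P], with [1] as one of them; this
is what puts it within reach of [thetaM]. *)
Lemma letter_evalP l :
  exists p q, [/\ P p, P q & letter_eval x l = p * q^-1].
Proof.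
case: l => i [] /=; first by exists 1, (x i); rewrite mul1g.
by exists (x i), 1; rewrite invg1 mulg1.
Qed.

Lemma theta1_quotient p q : P p -> P q ->
  theta 1 * theta (p * q^-1) = theta (p * q^-1).
Proof. by move=> Pp Pq; rewrite -(mulgV p) thetaM. Qed.

Lemma theta1_letter l : theta 1 * theta (letter_eval x l) = theta (letter_eval x l).
Proof. by have [p [q [Pp Pq ->]]] := letter_evalP l; rewrite theta1_quotient. Qed.

Lemma theta1_image w : theta 1 * image w = image w.
Proof.
case: w => [|l w] /=; last by rewrite mulgA theta1_letter.
by rewrite -{2 3}(mulgV 1) theta1_quotient.
Qed.

Lemma word_image_cat v w : image (v ++ w) = image v * image w.
Proof. by elim: v => [|l v IH] /=; rewrite ?theta1_image // IH mulgA. Qed.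

Lemma word_image_cancel i b : image [:: (i, b); (i, ~~ b)] = theta 1.
Proof.
rewrite /image /=.
have -> : letter_eval x (i, ~~ b) = (letter_eval x (i, b))^-1.
  by case: b; rewrite /letter_eval /= ?invgK.
have [p [q [Pp Pq ->]]] := letter_evalP (i, b).
have thetaK : theta (p * q^-1) * theta (q * p^-1) = theta 1.
  by rewrite thetaM // mulgV.
have theta11 : theta (q * p^-1) * theta 1 = theta (q * p^-1).
  by rewrite -(mulgV p) thetaM.
by rewrite invgM invgK theta11 thetaK.
Qed.

(** Splitting off the first letter [l] of [l :: w] is the instance of [thetaM]
at the values of [l :: w], of [w] and [1]. *)
Lemma word_image_suffixes w :
  (forall u v, u ++ v = w -> P (word_eval x v)) -> image w = theta (word_eval x w).
Proof.
elim: w => [|l w IH] sufP /=; first by rewrite /word_eval big_nil.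
have Pw : P (word_eval x w) by apply: (sufP [:: l]).
have Plw : P (word_eval x (l :: w)) by apply: (sufP [::]).
rewrite IH; last by move=> u v uv; apply: (sufP (l :: u)); rewrite /= uv.
have -> : letter_eval x l = word_eval x (l :: w) * (word_eval x w)^-1.
  by rewrite word_eval_cons mulgK.
have := thetaM Plw Pw P1.
by rewrite invg1 !mulg1.
Qed.

Lemma word_image_presented (R : seq (word k)) :
  (forall r, r \in R -> image r = theta 1) ->
  forall v w, presented_eq R v w -> image v = image w.
Proof.
move=> Rtriv v w; elim=> // {v w} [u v w _ -> _ -> //|u v i b|u v r /Rtriv rT].
  by rewrite word_image_cat word_image_cat word_image_cancel theta1_image
             -word_image_cat.
by rewrite !word_image_cat rT theta1_image.
Qed.

(** The multiplicative map is the image of any word representing the given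
element; it agrees with [theta] at [w0] and at the empty word. *)
Lemma presented_extension (R : seq (word k)) (w0 : word k) :
  (forall g, exists w, word_eval x w = g) ->
  (forall v w, word_eval x v = word_eval x w -> presented_eq R v w) ->
  (forall r, r \in R -> word_eval x r = 1) ->
  (forall u v, u ++ v \in w0 :: R -> P (word_eval x v)) ->
  exists2 F : G -> H, {morph F : g h / g * h} &
    F (word_eval x w0) = theta (word_eval x w0) /\ F 1 = theta 1.
Proof.
move=> surj inj Rtriv sufP.
have imageR v w : word_eval x v = word_eval x w -> image v = image w.
  move=> /inj; apply: word_image_presented => r rR.
  rewrite word_image_suffixes ?Rtriv // => u v' uv.
  by apply: (sufP u); rewrite uv inE rR orbT.
have [wd wdK] := choice surj.
exists (image \o wd) => [g h|]; rewrite /=.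
  by rewrite -word_image_cat; apply: imageR; rewrite word_eval_cat !wdK.
split.
  rewrite (imageR _ w0) ?wdK // word_image_suffixes // => u v uv.
  by apply: (sufP u); rewrite uv mem_head.
by rewrite (imageR _ [::]) // wdK /word_eval big_nil.
Qed.

End PresentedExtension.

(** * Graded algebras *)

Section GradedAlgebras.
Local Open Scope ring_scope.

Lemma component0 (F : fieldType) (S : semigroupType) (A : algType F)
  (V : grading S A) s : V s 0.
Proof. by have [/set_mem] := gr_submod V s. Qed.

Lemma componentN (F : fieldType) (S : semigroupType) (A : algType F)
  (V : grading S A) s a : V s a -> V s (- a).
Proof.
move=> Va; have [/set_mem V0 lin] := gr_submod V s.
by have := lin (-1) a 0 (mem_set Va) (mem_set V0); rewrite scaleN1r addr0 inE.
Qed.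

Lemma homogeneous_degree_unique (F : fieldType) (S : semigroupType)
    (A : algType F) (V : grading S A) s t a :
  V s a -> V t a -> a != 0 -> s = t.
Proof.
move=> Vs Vt a0; apply/eqP/negPn/negP => st; case/eqP: a0.
(* directness applied to the relation a + (- a) = 0 *)
pose f u := if u == s then a else if u == t then - a else 0.
have Vf u : V u (f u).
  rewrite /f; case: eqP => [->//|_]; case: eqP => [->|_]; last exact: component0.
  exact: componentN.
have ust : uniq [:: s; t] by rewrite /= inE st.
have := gr_direct ust Vf; rewrite !big_cons big_nil /f !eqxx eq_sym (negPf st).
by rewrite addr0 subrr => /(_ erefl s); rewrite mem_head eqxx => ->.
Qed.

End GradedAlgebras.

Section ElementaryGrading.
Local Open Scope ring_scope.
Local Open Scope classical_set_scope.
Variables (F : fieldType) (G : groupType) (n : nat) (g : 'I_n.+1 -> G).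

Definition unit_degree (i j : 'I_n.+1) : G := (g i * (g j)^-1)%g.

Definition elementary_component (s : G) : set 'M[F]_n.+1 :=
  [set A | forall i j, A i j != 0 -> unit_degree i j = s].

Lemma elementary_submod s : submod_closed [in elementary_component s].
Proof.
split; first by rewrite inE => i j; rewrite mxE eqxx.
move=> a A B; rewrite !inE => As Bs i j; rewrite !mxE => nz.
have [Aij|/As//] := eqVneq (A i j) 0.
by move: nz; rewrite Aij mulr0 add0r => /Bs.
Qed.

Lemma elementary_total (A : 'M[F]_n.+1) :
  exists (r : seq G) (f : G -> 'M[F]_n.+1),
    [/\ uniq r, (forall s, elementary_component s (f s)) & A = \sum_(s <- r) f s].
Proof.
exists (undup [seq unit_degree p.1 p.2 | p : 'I_n.+1 * 'I_n.+1]).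
exists (fun s => \matrix_(i, j) if unit_degree i j == s then A i j else 0).
split=> [|s i j|]; first exact: undup_uniq.
  by rewrite mxE; case: (_ =P s) => //; rewrite eqxx.
apply/matrixP => i j; rewrite summxE.
rewrite (bigD1_seq (unit_degree i j)) ?undup_uniq //=; last first.
  by rewrite mem_undup; apply/mapP; exists (i, j); rewrite ?mem_enum.
rewrite mxE eqxx big1 ?addr0 // => s /negPf sd.
by rewrite mxE eq_sym sd.
Qed.

Lemma elementary_direct (r : seq G) (f : G -> 'M[F]_n.+1) :
  uniq r -> (forall s, elementary_component s (f s)) -> \sum_(s <- r) f s = 0 ->
  forall s, s \in r -> f s = 0.
Proof.
move=> ur fE sum0 s sr; apply/matrixP => i j; rewrite [RHS]mxE.
apply/eqP/negPn/negP => nz.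
have sum_ij : (\sum_(t <- r) f t) i j = f s i j.
  rewrite summxE (bigD1_seq s) //= big1 ?addr0 // => t ts.
  apply/eqP/negPn/negP => nz'; case/eqP: ts.
  by rewrite -(fE _ _ _ nz) -(fE _ _ _ nz').
by move: nz; rewrite -sum_ij sum0 mxE eqxx.
Qed.

Lemma elementary_mul (s t : G) (A B : 'M[F]_n.+1) :
  elementary_component s A -> elementary_component t B ->
  elementary_component (s * t)%g (A * B).
Proof.
move=> As Bt i j; rewrite mxE => nz.
have [l nzl] : exists l, A i l * B l j != 0.
  apply/existsP; apply: contraNT nz => /existsPn zero.
  by rewrite big1 // => l _; apply/eqP/negPn/zero.
move: nzl; rewrite mulf_eq0 negb_or => /andP[/As <- /Bt <-].
by rewrite /unit_degree mulgA mulgVK.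
Qed.

Definition elementary : grading G 'M[F]_n.+1 :=
  Grading elementary_submod elementary_total elementary_direct elementary_mul.

Lemma elementaryP : elementary_grading g elementary.
Proof.
move=> i j i' j'; rewrite mxE.
by case: (i' =P i) => [->|]; case: (j' =P j) => [->|]; rewrite //= eqxx.
Qed.

Lemma delta_mx_neq0 (i j : 'I_n.+1) : delta_mx i j != 0 :> 'M[F]_n.+1.
Proof.
by apply/eqP => /matrixP/(_ i j)/eqP; rewrite !mxE !eqxx oner_eq0.
Qed.

Lemma elementary_unit_degree s i j :
  elementary s (delta_mx i j) -> unit_degree i j = s.
Proof. by move=> /(_ i j); rewrite mxE !eqxx oner_eq0; apply. Qed.

(** Products of consecutive matrix units are nonzero, which forces the degrees of
their images to multiply; a repeated degree would give two components the same
image. *)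
Lemma weak_equivalence_degree_map (H : semigroupType) (B : algType F)
    (V : grading H B) : weakly_equivalent elementary V ->
  exists theta : G -> H, quotient_morph (range g) theta /\
    forall i j i' j', theta (unit_degree i j) = theta (unit_degree i' j') ->
      unit_degree i j = unit_degree i' j'.
Proof.
move=> [phi [phi_bij phiV]].
have phi_inj := bij_inj phi_bij.
have supp i j : elementary (unit_degree i j) <> [set 0].
  move=> E; have := @elementaryP i j; rewrite E => /eqP.
  by rewrite (negPf (delta_mx_neq0 i j)).
(* a value for theta off the support *)
have [h0 _] := phiV _ (supp ord0 ord0).
have /choice[theta thetaP] s : exists t,
    elementary s <> [set 0] -> phi @` elementary s = V t.
  have [/phiV[t Et]|triv] := pselect (elementary s <> [set 0]); first by exists t.
  by exists h0.
have thetaE i j : phi @` elementary (unit_degree i j) = V (theta (unit_degree i j)).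
  exact: thetaP.
have unitV i j : V (theta (unit_degree i j)) (phi (delta_mx i j)).
  by rewrite -thetaE; exists (delta_mx i j) => //; apply: elementaryP.
exists theta; split=> [_ _ _ [i _ <-] [j _ <-] [l _ <-]|i j i' j' eq_theta].
  apply: (homogeneous_degree_unique (a := phi (delta_mx i l))) (unitV i l) _.
    by rewrite -(mul_delta_mx (j : 'I_n.+1)) rmorphM; apply: gr_mul; apply: unitV.
  by rewrite raddf_eq0 ?delta_mx_neq0.
have := unitV i j; rewrite eq_theta -thetaE => -[A AE /phi_inj Aij].
by apply: elementary_unit_degree; rewrite -Aij.
Qed.

End ElementaryGrading.

(** * The tuple of suffix values *)

Section SuffixTuple.
Local Open Scope classical_set_scope.
Variables (G : groupType) (k : nat) (x : 'I_k -> G).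

Definition suffixes (k : nat) (w : word k) : seq (word k) :=
  [seq drop i w | i <- iota 0 (size w).+1].

Definition suffix_words (W : seq (word k)) : seq (word k) :=
  flatten [seq suffixes w | w <- W] ++ [seq [:: (i, false)] | i <- enum 'I_k].

(** The tuple has one entry more than there are words; the default value of [nth]
puts the empty word there. *)
Definition suffix_tuple (W : seq (word k)) (i : 'I_(size (suffix_words W)).+1) : G :=
  word_eval x (nth [::] (suffix_words W) i).

Lemma suffix_tuple_word W w :
  w \in suffix_words W -> range (@suffix_tuple W) (word_eval x w).
Proof.
move=> wW; have ltw : (index w (suffix_words W) < (size (suffix_words W)).+1)%N.
  by rewrite ltnS index_size.
by exists (Ordinal ltw) => //=; rewrite /suffix_tuple /= nth_index.
Qed.

Lemma suffix_tuple1 W : range (@suffix_tuple W) 1%g.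
Proof. by exists ord_max; rewrite // /suffix_tuple nth_default // /word_eval big_nil. Qed.

Lemma suffix_tuple_generator W i : range (@suffix_tuple W) (x i).
Proof.
have <- : word_eval x [:: (i, false)] = x i by rewrite /word_eval big_seq1.
apply: suffix_tuple_word; rewrite mem_cat; apply/orP; right.
by apply/mapP; exists i; rewrite ?mem_enum.
Qed.

Lemma suffix_tuple_suffix W u v :
  u ++ v \in W -> range (@suffix_tuple W) (word_eval x v).
Proof.
move=> uvW; apply: suffix_tuple_word; rewrite mem_cat; apply/orP; left.
apply/flatten_mapP; exists (u ++ v) => //; apply/mapP; exists (size u).
  by rewrite mem_iota size_cat /= add0n ltnS leq_addr.
by rewrite drop_size_cat.
Qed.

End SuffixTuple.

(** * Gradings by groups that are not residually finite *)

Lemma nontrivial_finite_residual (G : groupType) :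
  ~ residually_finite G -> exists2 g : G, finite_residual g & g <> 1%g.
Proof.
move=> nrf; apply: contrapT => nores; apply: nrf; apply/seteqP; split=> g /=.
  by move=> resg; apply: contrapT => g1; apply: nores; exists g.
by move=> -> N [[[/set_mem]]].
Qed.

Theorem theorem5p5 (F : fieldType) (G : groupType) :
  finitely_presented G -> ~ residually_finite G ->
  exists (n : nat) (g : 'I_n.+1 -> G) (U : grading G 'M[F]_n.+1),
    elementary_grading g U /\
    forall (H : semigroupType) (B : algType F) (V : grading H B),
      finite_set [set: H]%classic -> ~ weakly_equivalent U V.
Proof.
move=> [k [R [x [surj eqR]]]] /nontrivial_finite_residual[g0 resg0 g0_neq1].
have [w0 w0E] := surj g0.
pose W := w0 :: R; pose g := @suffix_tuple _ _ x W.
exists (size (suffix_words W)), g, (elementary F g); split; first exact: elementaryP.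
move=> H B V finH /weak_equivalence_degree_map[theta [thetaM theta_inj]].
have Rtriv r : r \in R -> word_eval x r = 1%g.
  move=> rR; have := presented_relator [::] [::] rR.
  by rewrite /= cats0 => /eqR ->; rewrite /word_eval big_nil.
have [f fM [fg0 f1]] : exists2 f : G -> H, {morph f : a b / (a * b)%g} &
    f (word_eval x w0) = theta (word_eval x w0) /\ f 1%g = theta 1%g.
  apply: (presented_extension (P := range g) _ _ thetaM surj _ Rtriv).
  - exact: suffix_tuple1.
  - exact: suffix_tuple_generator.
  - by move=> v w /eqR.
  - exact: suffix_tuple_suffix.
have theta_g0 : theta g0 = theta 1%g.
  by rewrite -w0E -fg0 -f1 w0E; apply: finite_residual_morph.
have [i1 _ gi1] := suffix_tuple1 x W.
have [i0 _ gi0] := @suffix_tuple_suffix _ _ x W [::] w0 (mem_head _ _).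
have deg0 : unit_degree g i0 i1 = g0.
  by rewrite /unit_degree /g gi0 gi1 invg1 mulg1.
have deg1 : unit_degree g i1 i1 = 1%g by rewrite /unit_degree mulgV.
by apply: g0_neq1; rewrite -deg0 -deg1; apply: theta_inj; rewrite deg0 deg1.
Qed.
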